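(* There exist constants $C_k>0$ ($k=0,1,2,\dots$) such that for all integers $n\ge1$, all $\sigma\in S_n$, and all integers $N>\sqrt{48}\,e\,n$ (with $e=2.718\ldots$ Euler's number), $$\left|N^{n+|\sigma|}\,\mathrm{Wg}_N^{\mathrm U}(\sigma)-\mathrm{Moeb}(\sigma)\right|\le\frac{C_{|\sigma|}\,n^2}{N^2-48e^2n^2}.$$ (That is, the constant $C_{|\sigma|}$ depends only on $|\sigma|$.)
   Context: $S_n$ is the group of permutations of $[n]=\{1,\dots,n\}$, and $S_0:=\{\varnothing\}$. For $\sigma\in S_n$ with $l$ cycles (fixed points count as cycles of length 1), $|\sigma|:=n-l$. $\mathrm{Cat}(k)=\frac{(2k)!}{k!(k+1)!}$. If the cycles of $\sigma$ have lengths $C_1,\dots,C_l$ (cycle lengths, not to be confused with the constants in the claim), then $\mathrm{Moeb}(\sigma):=(-1)^{|\sigma|}\prod_{i=1}^l \mathrm{Cat}(C_i-1)$. Unitary Weingarten graph: the directed graph with vertex set $\bigsqcup_{n\ge 0}S_n$ and two kinds of edges. For $\sigma,\sigma'\in S_n$ there is a solid edge $\sigma\to\sigma'$ if $\sigma'=(i\; n)\sigma$ for some $1\le i\le n-1$. If $\sigma\in S_n$ ($n\ge1$) fixes $n$, there is a dashed edge $\sigma\to\sigma|_{[n-1]}\in S_{n-1}$. $\mathrm P(\sigma,l)$ is the set of directed paths from $\sigma$ to $\varnothing$ using exactly $l$ solid edges. Unitary Weingarten function: for $n\le N$ and $\sigma\in S_n$, $$\mathrm{Wg}^{\mathrm U}_N(\sigma)=(-1)^{|\sigma|}N^{-n-|\sigma|}\sum_{g=0}^\infty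 |\mathrm P(\sigma,|\sigma|+2g)|\,N^{-2g}$$ (a convergent series). *)

(* Defs.v *)
From mathcomp Require Import all_boot all_order all_fingroup all_algebra finmap.
From mathcomp Require Import all_classical all_reals all_analysis.

Set Implicit Arguments.
Unset Strict Implicit.
Unset Printing Implicit Defensive.

Import Order.TTheory GRing.Theory Num.Theory.
Import numFieldNormedType.Exports.

Local Open Scope classical_set_scope.
Local Open Scope ring_scope.

(* Permutations of {1, ..., n} are permutations of 'I_n = {0, ..., n - 1}; for
   n = m.+1 the last point "n" is [ord_max : 'I_m.+1].  The set [porbits s]
   contains the supports of all the cycles of [s], fixed points included. *)

Definition plength (n : nat) (s : 'S_n) : nat := (n - #|porbits s|)%N.

Definition Cat (R : realType) (k : nat) : R :=
  ((2 * k)`!)%N%:R / ((k`!)%N%:R * ((k.+1)`!)%N%:R).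

Definition Moeb (R : realType) (n : nat) (s : 'S_n) : R :=
  (-1) ^+ plength s * \prod_(c in porbits s) Cat R (#|c| - 1)%N.

Definition vertex : Type := {n : nat & 'S_n}.

Definition vtx (n : nat) (s : 'S_n) : vertex := existT (fun n => 'S_n) n s.

Definition vempty : vertex := vtx (1%g : 'S_0).

(* In MathComp [(s * t)%g] maps x to [t (s x)], so [(s * tperm i ord_max)%g] is
   the composite (i n) o s, which is written (i n)s in the usual notation. *)
Definition solid_edge (v w : vertex) : Prop :=
  exists (m : nat) (s : 'S_m.+1) (i : 'I_m.+1),
    [/\ i != ord_max, v = vtx s & w = vtx (s * tperm i ord_max)%g].

Definition dashed_edge (v w : vertex) : Prop :=
  exists (m : nat) (s : 'S_m.+1) (t : 'S_m),
    [/\ s ord_max = ord_max,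
        forall i : 'I_m,
          s (widen_ord (leqnSn m) i) = widen_ord (leqnSn m) (t i),
        v = vtx s & w = vtx t].

(* [wpath v p l]: the vertices [v :: p] form a directed path from [v] to the
   empty permutation with exactly [l] solid edges.  The graph has no parallel
   edges, so that a directed path is determined by its sequence of vertices. *)
Inductive wpath : vertex -> seq vertex -> nat -> Prop :=
| wpath_nil : wpath vempty [::] 0
| wpath_solid v w p l :
    solid_edge v w -> wpath w p l -> wpath v (w :: p) l.+1
| wpath_dashed v w p l :
    dashed_edge v w -> wpath w p l -> wpath v (w :: p) l.

Definition paths (n : nat) (s : 'S_n) (l : nat) : set (seq vertex) :=
  [set p | wpath (vtx s) p l].

(* [paths s l] is finite: its elements all have length n + l, and every vertex
   has finitely many out-neighbours.  Hence [fset_set] does not truncate it. *)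
Definition npaths (n : nat) (s : 'S_n) (l : nat) : nat :=
  #|` fset_set (paths s l)|.

Definition WgU (R : realType) (N n : nat) (s : 'S_n) : R :=
  (-1) ^+ plength s * N%:R ^- (n + plength s)%N
  * limn (series (fun g : nat =>
            (npaths s (plength s + 2 * g)%N)%:R * N%:R ^- (2 * g)%N : R)).

(* Main.v *)
Require Import Defs.
From mathcomp Require Import all_boot all_order all_fingroup all_algebra finmap.
From mathcomp Require Import all_classical all_reals all_analysis.
From mathcomp Require Import zify ring lra.

(* Write k = |s| and let a(s, g) be the number of paths from s with k + 2g solid
   edges.  A solid edge (i n) either cuts the cycle of n in two, which lowers k
   and keeps g, or joins it to another cycle, which raises k and lowers g.  For
   g = 0 only cuts occur, and Segner's recurrence for the Catalan numbers gives
   (-1)^k a(s, 0) = Moeb s.  For g > 0 there are at most k cuts and n joins, and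
   induction gives a(s, g) <= 16^g (k + g)!/g! n^(2g) as long as g < n; when
   g >= n the same bound follows from the crude count 2^(n + l) n^l of all paths
   with l solid edges.  Thus a(s, g) <= 2^k k! (32 n^2)^g, and as 32 <= 48 e^2
   the terms g > 0 of the Weingarten series are dominated by a geometric series
   of ratio 48 e^2 n^2 / N^2. *)

Set Implicit Arguments.
Unset Strict Implicit.
Unset Printing Implicit Defensive.

Import Order.TTheory GRing.Theory Num.Theory.
Import numFieldNormedType.Exports.

(** * Cycles of a permutation, and how a transposition cuts them *)

Lemma porbit_period (T : finType) (u : {perm T}) (y : T) (d : nat) :
  0 < d -> iter d u y = y -> porbit u y =i traject u y d.
Proof.
move=> d0 dy z; apply/porbitP/trajectP => [[i ->]|[i _ ->]]; last first.
  by exists i; rewrite permX.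
exists (i %% d); first by rewrite ltn_pmod.
rewrite permX {1}(divn_eq i d) addnC iterD; congr (iter _ u _).
by elim: (i %/ d) => [//|q IH]; rewrite mulSn iterD IH.
Qed.

Lemma eq_porbit (T : finType) (s u : {perm T}) (y : T) :
  {in porbit s y, u =1 s} -> porbit u y = porbit s y.
Proof.
move=> us; have e i : iter i u y = iter i s y.
  by elim: i => [//|i IH]; rewrite /= IH us // -permX mem_porbit.
by apply/porbit_setP => z; apply/porbitP/porbitP => -[i ->]; exists i;
  rewrite !permX e.
Qed.

Lemma iter_perm_inj (T : finType) (s : {perm T}) (x : T) (a b : nat) :
  a < #|porbit s x| -> b < #|porbit s x| -> iter a s x = iter b s x -> a = b.
Proof.
move=> ac bc; rewrite -(nth_traject s ac) -(nth_traject s bc) => /eqP.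
by rewrite nth_uniq ?size_traject ?uniq_traject_porbit // => /eqP.
Qed.

(* [s] followed by [tperm (s^j x) x] cuts the cycle (x, s x, ...) just before
   its [j]-th element. *)
Lemma porbit_mul_tperm (T : finType) (s : {perm T}) (x : T) (j : nat)
    (y : T) (d : nat) :
  0 < j < #|porbit s x| ->
  y = x /\ d = j \/ y = iter j s x /\ d = #|porbit s x| - j ->
  porbit (s * tperm (iter j s x) x)%g y =i traject s y d.
Proof.
set c := #|porbit s x|; set u := (_ * _)%g => /andP[j0 jc] yd.
have uE i : i.+1 < c -> i.+1 != j -> u (iter i s x) = iter i.+1 s x.
  move=> ic ij; rewrite permM -iterS tpermD //; last first.
    by apply/eqP => /(@iter_perm_inj _ s x 0 i.+1); lia.
  by apply: contraNneq ij => /(iter_perm_inj jc ic) ->.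
have d0 : 0 < d by case: yd => -[_ ->] //; lia.
have uY i : i.+1 < d -> u (iter i s y) = iter i.+1 s y.
  by case: yd => -[-> ->] ij; rewrite -?iterD uE //; lia.
have agr i : i < d -> iter i u y = iter i s y.
  by elim: i => [//|i IH] id; rewrite /= IH ?uY // ltnW.
(* [s] sends the last element of either segment to the start of the other one, and the transposition
   sends that back to [y]. *)
have loop : iter d u y = y.
  rewrite -{1}(prednK d0) iterS agr ?prednK // permM -iterS prednK //.
  case: yd => -[-> ->]; first by rewrite tpermL.
  by rewrite -iterD subnK ?iter_porbit ?tpermR // ltnW.
move=> z; rewrite (porbit_period d0 loop); congr (z \in _).
apply: (@eq_from_nth _ y); rewrite ?size_traject // => i id.
by rewrite !nth_traject // agr.
Qed.

Lemma card_porbit_mul_tperm (T : finType) (s : {perm T}) (x : T) (j : nat) :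
  let u := (s * tperm (iter j s x) x)%g in
  0 < j < #|porbit s x| ->
  #|porbit u x| = j /\ #|porbit u (iter j s x)| = #|porbit s x| - j.
Proof.
move=> u jc; have [j0 /ltnW jc'] := andP jc.
have := uniq_traject_porbit s x.
rewrite -{1}(subnKC jc') trajectD cat_uniq => /and3P[U1 _ U2].
rewrite (eq_card (porbit_mul_tperm jc (or_introl _ (conj erefl erefl)))).
rewrite (eq_card (porbit_mul_tperm jc (or_intror _ (conj erefl erefl)))).
by rewrite !(card_uniqP _) ?size_traject.
Qed.

(** Cycles other than that of [x] meet neither transposed point, so [u] keeps them. The two
    non-membership clauses allow a product over [porbits u] to be peeled off by [big_setU1]. *)
Lemma porbits_split (T : finType) (s : {perm T}) (x : T) (j : nat) :
  let u := (s * tperm (iter j s x) x)%g in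
  0 < j < #|porbit s x| ->
  [/\ porbits u = porbit u x |: (porbit u (iter j s x)
                    |: (porbits s :\ porbit s x)),
      porbit u x \notin porbit u (iter j s x) |: (porbits s :\ porbit s x)
    & porbit u (iter j s x) \notin porbits s :\ porbit s x].
Proof.
move=> u jc; have [j0 /ltnW jc'] := andP jc.
have O1 := porbit_mul_tperm jc (or_introl _ (conj erefl erefl)).
have O2 := porbit_mul_tperm jc (or_intror _ (conj erefl erefl)).
have OE z : (z \in porbit s x) =
    (z \in porbit u x) || (z \in porbit u (iter j s x)).
  by rewrite porbit_traject -{1}(subnKC jc') trajectD mem_cat O1 O2.
have oth y : y \notin porbit s x -> porbit u y = porbit s y.
  move=> yx; apply: eq_porbit => z zy; rewrite permM tpermD //.
    apply: contraNneq yx => E; rewrite porbit_sym.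
    rewrite -eq_porbit_mem -(porbit_perm s j) permX E (porbit_perm s 1).
    by rewrite eq_porbit_mem.
  apply: contraNneq yx => ->; rewrite porbit_sym.
  by rewrite -eq_porbit_mem (porbit_perm s 1) eq_porbit_mem.
have inO y (A : {set T}) :
    y \in A -> y \in porbit s x -> A \notin porbits s :\ porbit s x.
  move=> yA yx; rewrite !inE negb_and negbK; case: eqP => //= ne.
  apply/imsetP => -[z _ Az]; apply: ne; rewrite Az.
  by apply/eqP; move: yA yx; rewrite Az -!eq_porbit_mem => /eqP <- /eqP ->.
have xs : iter j s x \in porbit s x by rewrite -permX mem_porbit.
split; last by apply: inO (porbit_id u _) xs.
  apply/setP => A; rewrite !in_setU1 !inE; apply/imsetP/idP.
    move=> [y _ ->]; case: (boolP (y \in porbit s x)) => [|yx].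
      by rewrite OE -!eq_porbit_mem => /orP[|] ->; rewrite ?orbT.
    by rewrite -[_ == porbit s x]negbK oth // eq_porbit_mem yx imset_f ?orbT.
  case/or3P => [/eqP ->|/eqP ->|/andP[neA /imsetP[y _ Ay]]].
  - by exists x.
  - by exists (iter j s x).
  by exists y => //; rewrite Ay oth // -eq_porbit_mem -Ay.
rewrite in_setU1 negb_or (inO x) ?porbit_id // andbT eq_porbit_mem O2.
apply/negP => /trajectP[i id]; rewrite -iterD => E.
by have := @iter_perm_inj _ s x 0 (i + j) _ _ E; lia.
Qed.

(** Indexing by the number of steps from [x] turns a sum over all cuts of the cycle into a sum over
    the length [j] of the first piece. *)
Lemma big_porbit (T : finType) (s : {perm T}) (x : T) (R : Type) (idx : R)
    (op : Monoid.com_law idx) (F : T -> R) :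
  \big[op/idx]_(i in porbit s x | i != x) F i =
  \big[op/idx]_(1 <= j < #|porbit s x|) F (iter j s x).
Proof.
rewrite big_mkcondr (eq_bigl _ _ (porbit_traject s x)).
rewrite -big_uniq ?uniq_traject_porbit // (big_nth x) size_traject.
have c0 : 0 < #|porbit s x| by rewrite lt0n card_porbit_neq0.
rewrite big_ltn // nth_traject //= eqxx Monoid.mul1m.
apply: eq_big_nat => j /andP[j0 jc]; rewrite nth_traject //.
by case: eqP => // /(@iter_perm_inj _ s x j 0 jc c0); lia.
Qed.

(** * Permutations fixing the last point, and the length |s| *)

(** The target of the dashed edge, made total: the value is the default [1] when [s] moves
    [ord_max]. *)
Definition unlift_max (m : nat) (s : 'S_m.+1) : 'S_m :=
  odflt 1%g [pick t | lift_perm ord_max ord_max t == s].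

Lemma lift_maxK (m : nat) :
  cancel (@lift_perm m ord_max ord_max) (@unlift_max m).
Proof.
move=> t; rewrite /unlift_max; case: pickP => [t' /eqP E|/(_ t)]; last first.
  by rewrite eqxx.
apply/permP => i; apply: (@lift_inj _ ord_max).
by rewrite -!(lift_perm_lift ord_max) E.
Qed.

Lemma unlift_maxK (m : nat) (s : 'S_m.+1) :
  s ord_max = ord_max -> lift_perm ord_max ord_max (unlift_max s) = s.
Proof.
move=> sm; have max_lift i : s (lift ord_max i) != ord_max.
  by rewrite -{2}sm (inj_eq perm_inj) eq_sym neq_lift.
pose f i := odflt i (unlift ord_max (s (lift ord_max i))).
have fE i : lift ord_max (f i) = s (lift ord_max i).
  by rewrite /f; case: unliftP (max_lift i) => [j ->|->]; rewrite ?eqxx.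
have f_inj : injective f.
  by move=> i j E; apply/(@lift_inj _ ord_max)/(@perm_inj _ s); rewrite -!fE E.
suff <- : lift_perm ord_max ord_max (perm f_inj) = s by rewrite lift_maxK.
apply/permP => i; case: (unliftP ord_max i) => [j ->|->].
  by rewrite lift_perm_lift permE fE.
by rewrite lift_perm_id sm.
Qed.

Lemma porbits_lift_max (m : nat) (t : 'S_m) :
  porbits (lift_perm ord_max ord_max t) =
  [set ord_max] |: [set lift ord_max @: c | c : {set 'I_m} in porbits t].
Proof.
set s := lift_perm _ _ t.
have iter_lift i j : iter i s (lift ord_max j) = lift ord_max (iter i t j).
  by elim: i => //= i ->; rewrite lift_perm_lift.
have O1 j : porbit s (lift ord_max j) = lift ord_max @: porbit t j.
  apply/setP => z; apply/porbitP/imsetP => [[i ->]|[_ /porbitP[i ->] ->]].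
    by exists (iter i t j); rewrite -?permX ?mem_porbit // !permX iter_lift.
  by exists i; rewrite !permX iter_lift.
have O2 : porbit s ord_max = [set ord_max].
  apply/setP => z; rewrite inE; apply/porbitP/eqP => [[i ->]|->]; last first.
    by exists 0; rewrite expg0 perm1.
  by elim: i => [|i IH]; rewrite ?expg0 ?perm1 // expgSr permM IH lift_perm_id.
apply/setP => c; rewrite !inE; apply/imsetP/orP.
  move=> [i _ ->]; case: (unliftP ord_max i) => [j ->|->]; last first.
    by rewrite O2; left.
  by right; rewrite O1; apply: imset_f; apply: imset_f.
case=> [/eqP ->|/imsetP[_ /imsetP[j _ ->] ->]]; first by exists ord_max.
by exists (lift ord_max j).
Qed.

(** Stated for any commutative monoid in order to serve twice: with [addn] it counts cycles, with
    [*%R] it multiplies Catalan numbers. *)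
Lemma big_porbits_lift_max (m : nat) (t : 'S_m) (R : Type) (idx : R)
    (op : Monoid.com_law idx) (F : nat -> R) :
  \big[op/idx]_(c in porbits (lift_perm ord_max ord_max t)) F #|c| =
  op (F 1) (\big[op/idx]_(c in porbits t) F #|c|).
Proof.
rewrite porbits_lift_max big_setU1 /=; last first.
  apply/imsetP => -[c _ E]; have := set11 (@ord_max m).
  by rewrite E => /imsetP[i _ /eqP]; rewrite (negbTE (neq_lift _ _)).
rewrite cards1 big_imset /=; last first.
  by move=> c d _ _; apply: imset_inj; apply: lift_inj.
congr (op _ _); apply: eq_bigr => c _.
by rewrite card_imset //; apply: lift_inj.
Qed.

Lemma card_porbits_leq (n : nat) (s : 'S_n) : #|porbits s| <= n.
Proof. by rewrite -[leqRHS]card_ord leq_imset_card. Qed.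

Lemma plength_lift_max (m : nat) (t : 'S_m) :
  plength (lift_perm ord_max ord_max t) = plength t.
Proof.
rewrite /plength -(sum1_card (mem (porbits (lift_perm _ _ _)))).
rewrite (@big_porbits_lift_max m t _ _ addn (fun=> 1)) /= sum1_card.
by rewrite add1n subSS.
Qed.

Lemma plength_mul_tperm (n : nat) (s : 'S_n) (i x : 'I_n) :
  i != x ->
  plength (s * tperm i x)%g + (i \in porbit s x) =
  plength s + (i \notin porbit s x).
Proof.
(* [porbits_mul_tperm] has the transposition on the left; inversion preserves the cycles and moves
   it to the right. *)
move=> ix; have := porbits_mul_tperm s^-1%g i x.
rewrite /= -(porbitsV (_ * _)%g) invMg tpermV invgK porbitsV porbitV ix.
rewrite /plength.
have := card_porbits_leq s; have := card_porbits_leq (s * tperm i x)%g.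
case: (_ \in _) => /=; rewrite ?double0 ?doubleS /=;
  by move: #|_| #|_| => a b; lia.
Qed.

(** The other cycles lie in the complement of that of [x], so there are at most [n - #|porbit s x|]
    of them. This bounds the number of cuts by |s|. *)
Lemma card_porbit_leq_plength (n : nat) (s : 'S_n) (x : 'I_n) :
  #|porbit s x| <= (plength s).+1.
Proof.
have : #|porbits s :\ porbit s x| <= #|~: porbit s x|.
  apply: leq_trans (leq_imset_card (porbit s) _); apply: subset_leq_card.
  apply/fintype.subsetP => A; rewrite !inE => /andP[neA /imsetP[y _ Ay]].
  by rewrite Ay imset_f // inE -eq_porbit_mem -Ay.
have := cardsD1 (porbit s x) (porbits s); rewrite imset_f //.
by have := cardsC (porbit s x); rewrite /plength card_ord; lia.
Qed.

(** * Edges out of a permutation, and enumeration of the paths *)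

Lemma vtx_inj (n : nat) : injective (@vtx n).
Proof.
by move=> s t; exact: Eqdep_dec.inj_pair2_eq_dec PeanoNat.Nat.eq_dec _ _ _ _.
Qed.

Lemma dashed_edgeE (m : nat) (s : 'S_m.+1) (w : vertex) :
  dashed_edge (vtx s) w <->
  s ord_max = ord_max /\ w = vtx (unlift_max s).
Proof.
have widE k (i : 'I_k) : widen_ord (leqnSn k) i = lift ord_max i.
  by apply: val_inj; rewrite /= /bump leqNgt ltn_ord.
split=> [[m' [s' [t [s'm s't E ->]]]]|[sm ->]].
  have [Em] : m = m' by case: (congr1 (@projT1 _ _) E).
  subst m'; move/vtx_inj: E => ?; subst s'; split=> //; congr vtx.
  suff <- : lift_perm ord_max ord_max t = s by rewrite lift_maxK.
  apply/permP => i; case: (unliftP ord_max i) => [j ->|->].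
    by rewrite lift_perm_lift -(widE _ j) s't widE.
  by rewrite lift_perm_id s'm.
exists m, s, (unlift_max s); split=> // i.
by rewrite !widE -{1}(unlift_maxK sm) lift_perm_lift.
Qed.

Lemma solid_edgeE (m : nat) (s : 'S_m.+1) (w : vertex) :
  solid_edge (vtx s) w <->
  exists2 i, i != ord_max & w = vtx (s * tperm i ord_max)%g.
Proof.
split=> [[m' [s' [i [ne E ->]]]]|[i ne ->]]; last by exists m, s, i.
have [Em] : m = m' by case: (congr1 (@projT1 _ _) E).
by subst m'; move/vtx_inj: E => ?; subst s'; exists i.
Qed.

(** A duplicate-free list of the paths, which turns [npaths] into a recurrence. The outer recursion
    on [n] follows dashed edges, the inner one on [l] solid edges. *)
Fixpoint path_seq (n : nat) : 'S_n -> nat -> seq (seq vertex) :=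
  match n with
  | 0 => fun s l => if l is 0 then [:: [::]] else [::]
  | m.+1 => fix loop s l :=
    (if s ord_max == ord_max
     then [seq vtx (unlift_max s) :: p | p <- path_seq (unlift_max s) l]
     else [::]) ++
    (if l is l'.+1
     then [seq vtx (s * tperm i ord_max)%g :: p | i <- enum (predC1 ord_max),
                p <- loop (s * tperm i ord_max)%g l']
     else [::])
  end.

Lemma path_seqS (m : nat) (s : 'S_m.+1) (l : nat) :
  path_seq s l =
    (if s ord_max == ord_max
     then [seq vtx (unlift_max s) :: p | p <- path_seq (unlift_max s) l]
     else [::]) ++
    (if l is l'.+1
     then [seq vtx (s * tperm i ord_max)%g :: p | i <- enum (predC1 ord_max),
                p <- path_seq (s * tperm i ord_max)%g l']
     else [::]).
Proof. by case: l. Qed.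

Lemma mem_path_seq (n : nat) (s : 'S_n) (l : nat) (p : seq vertex) :
  p \in path_seq s l <-> wpath (vtx s) p l.
Proof.
elim: n s l p => [|m IHm] s l p.
  split.
    case: l => //=; rewrite inE => /eqP ->.
    suff -> : vtx s = vempty by constructor.
    by congr vtx; apply/permP => -[].
  move Ev: (vtx s) => v wv; case: wv Ev => //=.
    by move=> v' w p' l' [m [s' [i [_ -> _]]]] _ /(congr1 (@projT1 _ _)).
  by move=> v' w p' l' [m [s' [t [_ _ -> _]]]] _ /(congr1 (@projT1 _ _)).
elim: l s p => [|l IHl] s p; rewrite path_seqS mem_cat; split.
- rewrite orbF; case: eqP => // sm /mapP[q /IHm qP ->].
  by apply: wpath_dashed qP; apply/dashed_edgeE.
- move El : 0%N => l; move Ev: (vtx s) => v wv; case: wv Ev El => //=.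
  move=> v' w p' l' de wp E El; subst v' l'.
  have [sm wE] := (dashed_edgeE _ _).1 de.
  by subst w; rewrite sm eqxx orbF map_f //; apply/IHm.
- case/orP.
    case: eqP => // sm /mapP[q /IHm qP ->].
    by apply: wpath_dashed qP; apply/dashed_edgeE.
  move=> /allpairsPdep[i [q [ii /IHl qP ->]]].
  apply: wpath_solid qP; apply/solid_edgeE; exists i => //.
  by rewrite mem_enum in ii.
- move El : l.+1 => l1; move Ev: (vtx s) => v wv; case: wv Ev El => //=.
    move=> v' w p' l' se wp E [El]; subst v' l'.
    have [i ii wE] := (solid_edgeE _ _).1 se; subst w.
    apply/orP; right; apply/allpairsPdep; exists i, p'; split=> //.
      by rewrite mem_enum.
    by apply/IHl.
  move=> v' w p' l' de wp E El; subst v' l'.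
  have [sm wE] := (dashed_edgeE _ _).1 de.
  by subst w; rewrite sm eqxx map_f //; apply/IHm.
Qed.

Lemma path_seq_uniq (n : nat) (s : 'S_n) (l : nat) : uniq (path_seq s l).
Proof.
have cons_inj (v : vertex) : injective (cons v) by move=> p q [].
elim: n s l => [|m IHm] s l; first by case: l.
elim: l s => [|l IHl] s; rewrite path_seqS cat_uniq.
  by rewrite andbT; case: eqP => // _; rewrite map_inj_uniq.
apply/and3P; split; first by case: eqP => // _; rewrite map_inj_uniq.
  (* The two lists are disjoint: the next vertex has size [m] after a dashed edge and [m.+1] after a
     solid one. *)
  apply/hasPn => _ /allpairsPdep[i [q [_ _ ->]]]; case: eqP => // _.
  by apply/mapP => -[q' _ /(congr1 (fun r => tag (head vempty r)))] /=; lia.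
apply: allpairs_uniq_dep => [|i _|]; rewrite ?enum_uniq //.
move=> [i p] [j q] _ _ /= E; have := congr1 (head vempty) E.
move=> /vtx_inj/mulgI/(congr1 (fun u : 'S_m.+1 => u ord_max)).
by rewrite !tpermR => ->; congr existT; have := congr1 behead E.
Qed.

Lemma npaths_size (n : nat) (s : 'S_n) (l : nat) :
  npaths s l = size (path_seq s l).
Proof.
rewrite /npaths.
have -> : paths s l = [set` [fset p in path_seq s l]%fset]%classic.
  by apply/seteqP; split => p /=; rewrite inE => /mem_path_seq.
by rewrite set_fsetK card_fseq undup_id ?path_seq_uniq.
Qed.

Lemma npaths0 (s : 'S_0) (l : nat) : npaths s l = (l == 0).
Proof. by rewrite npaths_size; case: l. Qed.

Lemma npathsS (m : nat) (s : 'S_m.+1) (l : nat) :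
  npaths s l =
    (if s ord_max == ord_max then npaths (unlift_max s) l else 0) +
    (if l is l'.+1
     then \sum_(i | i != ord_max) npaths (s * tperm i ord_max)%g l' else 0).
Proof.
rewrite !npaths_size path_seqS size_cat; congr addn.
  by case: ifP => // _; rewrite size_map.
case: l => // l; rewrite size_allpairs_dep sumnE big_map big_enum /=.
by apply: eq_big => i; rewrite ?npaths_size.
Qed.

(** * Upper bounds on the number of paths *)

Lemma plength_unlift_max (m : nat) (s : 'S_m.+1) :
  s ord_max = ord_max -> plength (unlift_max s) = plength s.
Proof. by move=> sm; rewrite -[in RHS](unlift_maxK sm) plength_lift_max. Qed.

Lemma plength_ltn (m : nat) (s : 'S_m.+1) : plength s < m.+1.
Proof.
rewrite /plength; suff : 0 < #|porbits s| by lia.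
by rewrite card_gt0; apply/set0Pn; exists (porbit s ord_max); apply: imset_f.
Qed.

(** Dashed edges keep |s|, a solid edge lowers it by at most one, and it is 0 at the end of the
    path. *)
Lemma npaths_small (n : nat) (s : 'S_n) (l : nat) :
  l < plength s -> npaths s l = 0.
Proof.
elim: n s l => [|m IHm] s l; first by rewrite /plength.
elim: l s => [|l IHl] s lt_l; rewrite npathsS.
  by case: eqP => // sm; rewrite IHm // plength_unlift_max.
rewrite big1 ?addn0 => [|i im].
  by case: eqP => // sm; rewrite IHm // plength_unlift_max.
by apply: IHl; have := plength_mul_tperm s im; lia.
Qed.

(** A path has [n] dashed and [l] solid edges: at most [2 ^ (n + l)] orders of the two kinds, and at
    most [n] choices for each solid edge. *)
Lemma npaths_leq_expn (n : nat) (s : 'S_n) (l : nat) :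
  npaths s l <= 2 ^ (n + l) * n ^ l.
Proof.
elim: n s l => [|m IHm] s l; first by rewrite npaths0; case: l.
have fixed (u : 'S_m.+1) l' :
    (if u ord_max == ord_max then npaths (unlift_max u) l' else 0) <=
    2 ^ (m + l') * m.+1 ^ l'.
  case: eqP => // _; apply: leq_trans (IHm _ _) _; rewrite leq_mul2l.
  by case: l' => [|l']; rewrite ?expn0 ?orbT // leq_exp2r // leqnSn orbT.
elim: l s => [|l IHl] s; rewrite npathsS.
  apply: leq_trans (leq_add (fixed s 0) (leqnn _)) _.
  by rewrite addn0 leq_mul2r leq_exp2l // addSn leqnSn orbT.
have solid : \sum_(i < m.+1 | i != ord_max) npaths (s * tperm i ord_max)%g l <=
    m * (2 ^ (m.+1 + l) * m.+1 ^ l).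
  have cm : #|predC1 (@ord_max m)| = m by rewrite cardC1 card_ord.
  by rewrite -[X in X * _]cm -sum_nat_const; apply: leq_sum.
apply: leq_trans (leq_add (fixed s _) solid) _.
rewrite !addSn addnS !expnS.
by move: (2 ^ _) (m.+1 ^ l) => a b; nia.
Qed.

Lemma expn_leq_ffact (a g k : nat) : a <= g -> a ^ k <= (k + g) ^_ k.
Proof.
move=> ag; elim: k => [//|k IH].
by rewrite addSn ffactSS expnS leq_mul //; lia.
Qed.

(** For [m > 0] this is ((m+1)/m)^j >= 1 + j/(m+1), a consequence of Bernoulli's inequality, with
    denominators cleared. *)
Lemma bernoulli_expn (m j : nat) : m ^ j * (m.+1 + j) <= m.+1 ^ j.+1.
Proof.
elim: j => [|j IH]; first by rewrite expn0 expn1; lia.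
rewrite [m ^ _]expnS [m.+1 ^ j.+2]expnS.
by have := leq_mul (leqnn m.+1) IH; nia.
Qed.

(* [(k + g) ^_ k = (k + g)! / g!]: the factorial growth in [k] pays for the at
   most [k] cuts, and the division by [g!] for the joins. *)
Definition genus_bound (k n g : nat) : nat :=
  16 ^ g * (k + g) ^_ k * n ^ (2 * g).

(** The induction step when [s] moves the last point: at most [k] cuts and at most [n] joins. *)
Lemma genus_bound_cut_join (k n g : nat) : 0 < k -> k + g.+1 <= 2 * n ->
  k * genus_bound k.-1 n g.+1 + n * genus_bound k.+1 n g
    <= genus_bound k n g.+1.
Proof.
case: k => // k _ kg; rewrite /genus_bound /=.
have -> : (k.+2 + g) ^_ k.+2 = (k.+1 + g.+1) * (k + g.+1) ^_ k * g.+1.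
  by rewrite addSnnS ffactnSr addSn ffactSS subSS addKn.
have -> : (k.+1 + g.+1) ^_ k.+1 = (k.+1 + g.+1) * (k + g.+1) ^_ k.
  by rewrite addSn ffactSS.
have -> : n ^ (2 * g.+1) = n * n * n ^ (2 * g) by rewrite mulnS expnD.
rewrite [16 ^ g.+1]expnS; move: (_ ^_ _) (16 ^ _) (n ^ (2 * g)) => f a b.
have -> : k.+1 * (16 * a * f * (n * n * b)) +
    n * (a * ((k.+1 + g.+1) * f * g.+1) * b) =
    a * f * b * n * (16 * k.+1 * n + (k.+1 + g.+1) * g.+1) by lia.
have -> : 16 * a * ((k.+1 + g.+1) * f) * (n * n * b) =
    a * f * b * n * (16 * (k.+1 + g.+1) * n) by lia.
(* After cancellation the claim is [k.+1 + g.+1 <= 16 * n], which the hypothesis gives with room to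
   spare. *)
by rewrite leq_mul2l; apply/orP; right; nia.
Qed.

(** The induction step when [s] fixes the last point: there are no cuts, and the joins are paid for
    by the growth of [n ^ (2 * g.+1)] from [m] to [m.+1]. *)
Lemma genus_bound_fixed (k m g : nat) : g <= m ->
  genus_bound k m g.+1 + m.+1 * genus_bound k.+1 m.+1 g
    <= genus_bound k m.+1 g.+1.
Proof.
move=> gm; rewrite /genus_bound.
have -> : (k.+1 + g) ^_ k.+1 = (k + g.+1) ^_ k * g.+1.
  by rewrite addSnnS ffactnSr addKn.
have := bernoulli_expn m (2 * g.+1).
have -> : m.+1 ^ (2 * g.+1).+1 = m.+1 * (m.+1 * m.+1 * m.+1 ^ (2 * g)).
  by rewrite expnS mulnS expnD.
have -> : m.+1 ^ (2 * g.+1) = m.+1 * m.+1 * m.+1 ^ (2 * g).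
  by rewrite mulnS expnD.
rewrite [16 ^ g.+1]expnS.
move: (_ ^_ _) (16 ^ _) (m ^ _) (m.+1 ^ _) => f a x y H.
suff H1 : 16 * x + m.+1 * g.+1 * y <= 16 * (m.+1 * m.+1 * y).
  by have := leq_mul (leqnn (a * f)) H1; lia.
(* This is the factor that multiplies [x] in [H]; what then remains follows from
   [m.+1 + 2 * g.+1 <= 32 * m.+1]. *)
rewrite -(@leq_pmul2r (m.+1 + 2 * g.+1)); last lia.
have H3 : m.+1 + 2 * g.+1 <= 3 * m.+1 by lia.
by have := leq_mul (leqnn (m.+1 * g.+1 * y)) H3; nia.
Qed.

Lemma porbit_fixed (T : finType) (s : {perm T}) (x : T) :
  s x = x -> #|porbit s x| = 1.
Proof.
by move=> sx; rewrite (eq_card (@porbit_period _ s x 1 isT sx)) (card_uniqP _).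
Qed.

Lemma npaths_leq_genus_bound (n : nat) (s : 'S_n) (g : nat) :
  npaths s (plength s + 2 * g) <= genus_bound (plength s) n g.
Proof.
elim: n s g => [|m IHm] s g.
  by rewrite npaths0 /genus_bound /plength sub0n; case: g.
(* The inner induction is on the number of solid edges, since a join raises |s| while lowering
   [g]. *)
have [l] := ubnP (plength s + 2 * g); elim: l s g => [//|l IHl] s g.
rewrite ltnS => le_l.
have [gm|mg] := leqP m.+1 g.
  apply: leq_trans (npaths_leq_expn _ _) _.
  rewrite /genus_bound (expnD m.+1) mulnA leq_mul2r; apply/orP; right.
  apply: leq_mul.
    rewrite -[16]/(2 ^ 4) -expnM leq_exp2l //; have := plength_ltn s; lia.
  exact: expn_leq_ffact.
have fixed : (if s ord_max == ord_max
    then npaths (unlift_max s) (plength s + 2 * g) else 0) <=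
    if s ord_max == ord_max then genus_bound (plength s) m g else 0.
  by case: eqP => // sm; rewrite -(plength_unlift_max sm) IHm.
rewrite npathsS; apply: leq_trans (leq_add fixed (leqnn _)) _ => {fixed}.
set O := porbit s ord_max.
have solid l' : l'.+1 = plength s + 2 * g ->
    \sum_(i | i != ord_max) npaths (s * tperm i ord_max)%g l' <=
    #|O|.-1 * genus_bound (plength s).-1 m.+1 g +
    m.+1 * (if g is g'.+1 then genus_bound (plength s).+1 m.+1 g' else 0).
  move=> El; rewrite (bigID (mem O)) /=; apply: leq_add.
    have -> : #|O|.-1 * genus_bound (plength s).-1 m.+1 g =
        \sum_(i | (i != ord_max) && (i \in O))
          genus_bound (plength s).-1 m.+1 g.
      rewrite sum_nat_const; congr muln.
      have := cardsD1 ord_max O; rewrite porbit_id => -> /=.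
      by apply: eq_card => i; rewrite !inE.
    apply: leq_sum => i /andP[im iO]; have := plength_mul_tperm s im.
    rewrite -/O iO addn1 addn0 => pE; rewrite -pE /=.
    have -> : l' = plength (s * tperm i ord_max)%g + 2 * g by lia.
    by apply: IHl; lia.
  rewrite -[X in X * _]card_ord -sum_nat_const.
  rewrite [leqRHS](bigID (fun i => (i != ord_max) && (i \notin O))) /=.
  apply: leq_trans (leq_addr _ _); apply: leq_sum => i /andP[im iO].
  have := plength_mul_tperm s im; rewrite -/O (negbTE iO) addn0 addn1 => pE.
  case: g {IHm mg} El le_l => [|g] El le_l.
    (* In genus 0 a join leaves fewer solid edges than the new length requires. *)
    by rewrite npaths_small // pE; lia.
  rewrite -pE.
  have -> : l' = plength (s * tperm i ord_max)%g + 2 * g by lia.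
  by apply: IHl; lia.
case: eqP => [sm|sm].
  rewrite /O porbit_fixed //= mul0n add0n in solid.
  case El: (plength s + 2 * g) solid => [|l'] solid.
    have -> : g = 0 by lia.
    by rewrite addn0 /genus_bound !muln0 !expn0 !muln1.
  apply: leq_trans (leq_add (leqnn _) (solid _ erefl)) _.
  case: (g) mg => [_|g' mg]; last by apply: genus_bound_fixed; lia.
  by rewrite /genus_bound !muln0 !expn0 addn0.
have k0 : 0 < plength s.
  rewrite lt0n; apply/eqP => k0; apply: sm.
  have := card_porbit_leq_plength s ord_max; rewrite k0 -/O => O1.
  have /cards1P[x Ox] : #|O| == 1 by rewrite eqn_leq O1 lt0n card_porbit_neq0.
  have : s ord_max \in O by apply: mem_porbit s 1 _.
  by have := porbit_id s ord_max; rewrite -/O Ox !inE => /eqP <- /eqP.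
rewrite add0n; case El: (plength s + 2 * g) solid => [|l'] solid; first by lia.
apply: leq_trans (solid _ erefl) _.
have kO : #|O|.-1 <= plength s.
  by have := card_porbit_leq_plength s ord_max; rewrite -/O; lia.
apply: leq_trans (leq_add (leq_mul kO (leqnn _)) (leqnn _)) _.
case: (g) mg => [_|g' mg]; last first.
  by apply: genus_bound_cut_join => //; have := plength_ltn s; lia.
rewrite /genus_bound !muln0 !addn0 !expn0; case: (plength s) k0 => // k _.
by rewrite !muln1 !mul1n ffactSS.
Qed.

Local Open Scope ring_scope.

(** * Catalan numbers and the paths of genus 0 *)

Lemma Cat0 (R : realType) : Cat R 0 = 1.
Proof. by rewrite /Cat !fact0 mulr1 divr1. Qed.

Lemma Cat_rec (R : realType) (n : nat) :
  n.+2%:R * Cat R n.+1 = (4 * n + 2)%N%:R * Cat R n.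
Proof.
rewrite /Cat mulnS !factS !natrM; field.
by rewrite nat1r -(natrD _ 2) !pnatr_eq0 -lt0n fact_gt0.
Qed.

(* By the symmetry [i <-> n - i], weighting the convolution by [i.+1] multiplies
   it by [n.+2 / 2]; and [Cat_rec] reduces the weighted sum to the convolution
   one step earlier. *)
Lemma Cat_convolution (R : realType) (n : nat) :
  \sum_(i < n.+1) Cat R i * Cat R (n - i)%N = Cat R n.+1.
Proof.
have weighted m : \sum_(i < m.+1) i.+1%:R * (Cat R i * Cat R (m - i)%N) =
    m.+2%:R / 2 * \sum_(i < m.+1) Cat R i * Cat R (m - i)%N.
  set S := LHS; set T := \sum_(i < _) _.
  suff : S + S = m.+2%:R * T by move=> SE; field: SE.
  rewrite {2}/S (reindex_inj rev_ord_inj) -big_split mulr_sumr /=.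
  apply: eq_bigr => i _; rewrite subSS.
  have im : (i <= m)%N by rewrite -ltnS.
  have mE : m.+2 = (i.+1 + (m - i).+1)%N by lia.
  by rewrite (subKn im) mE natrD; ring.
elim: n => [|n IH].
  rewrite big_ord1 subnn Cat0 (_ : Cat R 1 = 1) ?mulr1 // /Cat !factS !fact0 /=.
  by field.
apply: (@mulfI _ (n.+3%:R / 2)).
  by rewrite mulf_neq0 ?invr_neq0 ?pnatr_eq0.
rewrite -weighted big_ord_recl /= Cat0 subn0 !mul1r.
have -> : \sum_(i < n.+1) (bump 0 i).+1%:R *
      (Cat R (bump 0 i) * Cat R (n.+1 - bump 0 i)%N) =
    (2 * n.+1)%N%:R * Cat R n.+1.
  have := weighted n; rewrite IH => W.
  transitivity (4 * (\sum_(i < n.+1) i.+1%:R * (Cat R i * Cat R (n - i)%N)) -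
     2 * (\sum_(i < n.+1) Cat R i * Cat R (n - i)%N)).
    rewrite !mulr_sumr -sumrB; apply: eq_bigr => i _.
    rewrite /bump leq0n add1n subSS mulrA Cat_rec -!natr1 natrD natrM; ring.
  by rewrite W IH natrM -!natr1; field.
by rewrite [RHS]mulrAC Cat_rec natrD !natrM; field.
Qed.

(** A dashed edge removes a factor [Cat R 0 = 1]. When the last point moves, only cuts contribute,
    and summing over them replaces the factor of its cycle by a Catalan convolution. *)
Lemma npaths_plength (R : realType) (n : nat) (s : 'S_n) :
  (npaths s (plength s))%:R = \prod_(c in porbits s) Cat R (#|c| - 1)%N.
Proof.
elim: n s => [|m IHm] s.
  rewrite npaths0 /plength sub0n big_pred0 // => c.
  by apply/imsetP => -[[]].
have [k] := ubnP (plength s); elim: k s => [//|k IHk] s; rewrite ltnS => le_k.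
set O := porbit s ord_max.
have join l i : i != ord_max -> i \notin O -> l.+1 = plength s ->
    npaths s l = 0 /\ npaths (s * tperm i ord_max)%g l = 0.
  move=> im iO El; have := plength_mul_tperm s im.
  by rewrite -/O (negbTE iO) => pE; split; apply: npaths_small; lia.
case: (eqVneq (s ord_max) ord_max) => sm.
  have := IHm (unlift_max s); rewrite plength_unlift_max // => IHs.
  rewrite npathsS sm eqxx natrD IHs.
  have := @big_porbits_lift_max m (unlift_max s) R 1 *%R
    (fun c => Cat R (c - 1)).
  rewrite unlift_maxK //= subnn Cat0 mul1r => ->.
  case El: (plength s) => [|l]; first by rewrite addr0.
  suff -> : (\sum_(i < m.+1 | i != ord_max)
      npaths (s * tperm i ord_max)%g l = 0)%N.
    by rewrite addr0.
  apply: big1 => i im; have [|//] := join l i im _ (esym El).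
  by rewrite porbit_traject porbit_fixed // inE.
rewrite npathsS (negbTE sm) add0n.
have c1 : (1 < #|O|)%N.
  rewrite ltn_neqAle eq_sym lt0n card_porbit_neq0 andbT.
  apply/negP => /cards1P[x Ox].
  have : s ord_max \in O by apply: mem_porbit s 1 _.
  move/eqP: sm => sm; have := porbit_id s ord_max.
  by rewrite -/O Ox !inE => /eqP <- /eqP.
case El: (plength s) => [|l].
  by have := card_porbit_leq_plength s ord_max; rewrite El -/O; lia.
rewrite (bigID (mem O)) /=.
rewrite [X in (_ + X)%N]big1 => [|i /andP[im iO]]; last first.
  by have [] := join l i im iO (esym El).
rewrite addn0 (eq_bigl (fun i => (i \in O) && (i != ord_max))); last first.
  by move=> i; rewrite andbC.
rewrite big_porbit natr_sum (big_setD1 O) ?imset_f //=.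
(* Pieces of lengths [j] and [#|O| - j] have Catalan indices adding up to [#|O| - 2], hence the
   shift by one against [Cat_convolution]. *)
have -> : Cat R (#|O| - 1) =
    \sum_(1 <= j < #|O|) Cat R (j - 1) * Cat R (#|O| - j - 1).
  rewrite -/O; case: #|O| c1 => [//|[//|n]] _.
  rewrite !subSS subn0 -Cat_convolution.
  rewrite big_add1 big_mkord; apply: eq_bigr => i _.
  by rewrite subn1 /= subSS subn1 subSn // -ltnS.
rewrite mulr_suml; apply: eq_big_nat => j jc.
have [uE nin1 nin2] := porbits_split jc.
have [c1E c2E] := card_porbit_mul_tperm jc.
have im : iter j s ord_max != ord_max.
  have [j0 jO] := andP jc; apply/eqP.
  move=> /(@iter_perm_inj _ s ord_max j 0 jO (ltnW c1)) jE.
  by rewrite jE in j0.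
have iO : iter j s ord_max \in O by rewrite -permX mem_porbit.
have := plength_mul_tperm s im; rewrite -/O iO addn0 addn1 El => -[pE].
rewrite -{1}pE IHk; last by lia.
by rewrite uE big_setU1 // big_setU1 //= c1E c2E mulrA.
Qed.

(** * Summation of the Weingarten series *)

Lemma bin_leq_expn (n m : nat) : ('C(n, m) <= 2 ^ n)%N.
Proof.
elim: n m => [|n IH] [|m] //; first by rewrite bin0 expn_gt0.
by rewrite binS expnS mul2n -addnn leq_add.
Qed.

(** The falling factorial is a binomial coefficient, at most [2 ^ (k + g)], times [k!]; the factor
    [2 ^ g] turns 16 into 32. *)
Lemma genus_bound_leq (k n g : nat) :
  (genus_bound k n g <= 2 ^ k * k`! * (32 * n ^ 2) ^ g)%N.
Proof.
rewrite /genus_bound -bin_ffact.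
have -> : (2 ^ k * k`! * (32 * n ^ 2) ^ g =
    16 ^ g * (2 ^ (k + g) * k`!) * n ^ (2 * g))%N.
  rewrite expnMn -expnM expnD -[32%N]/(16 * 2)%N expnMn; ring.
by rewrite !leq_mul // bin_leq_expn.
Qed.

Lemma le_lim_series_bounded (R : realType) (u : nat -> R) (B : R) :
  (forall g, 0 <= u g) -> (forall m, series u m.+1 <= u 0 + B) ->
  u 0 <= limn (series u) <= u 0 + B.
Proof.
move=> u0 uB.
have nd : {homo series u : m n / (m <= n)%N >-> m <= n}.
  by exact: nondecreasing_series.
have ub m : series u m <= u 0 + B.
  by apply: le_trans (uB m); apply: nd.
have cv : cvgn (series u).
  by apply: nondecreasing_is_cvgn => //; exists (u 0 + B) => _ [m _ <-].
apply/andP; split; last by apply: limr_le => //; apply: nearW.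
apply: limr_ge => //; exists 1 => // m /= m1.
by have := nd _ _ m1; rewrite /series /= big_nat1.
Qed.

(** With the factor [1 - x] included, the partial sums of the majorant telescope to
    [B * (1 - x ^+ m)]. *)
Lemma series_geometric_bound (R : realType) (u : nat -> R) (B x : R) (m : nat) :
  0 <= x -> 0 <= B -> (forall g, u g.+1 <= B * (1 - x) * x ^+ g) ->
  series u m.+1 <= u 0 + B.
Proof.
move=> x0 B0 uB; suff : series u m.+1 <= u 0 + B * (1 - x ^+ m).
  by move/le_trans; apply; rewrite lerD2l ler_piMr // gerBl exprn_ge0.
elim: m => [|m IH]; first by rewrite /series /= big_nat1 subrr mulr0 addr0.
rewrite seriesSr; apply: le_trans (lerD IH (uB m)) _.
by rewrite exprS le_eqVlt; apply/orP; left; apply/eqP; ring.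
Qed.

Theorem theorem1p4 (R : realType) :
  exists C : nat -> R,
    (forall k : nat, 0 < C k) /\
    (forall (n : nat) (s : 'S_n) (N : nat),
       (1 <= n)%N ->
       Num.sqrt 48 * expR 1 * n%:R < N%:R :> R ->
       `| N%:R ^+ (n + plength s)%N * WgU R N s - Moeb R s |
         <= C (plength s) * n%:R ^+ 2
            / (N%:R ^+ 2 - 48 * expR 1 ^+ 2 * n%:R ^+ 2)).
Proof.
(* [2 ^ k * k!] comes from [genus_bound_leq], and 32 from the leading factor 32 n^2 / N^2 of the
   terms with [g > 0]. *)
exists (fun k => 32 * (2 ^ k * k`!)%N%:R); split => [k|n s N n1 lt_N].
  by rewrite mulr_gt0 // ltr0n muln_gt0 expn_gt0 fact_gt0.
move=> /=; set k := plength s; set B := leRHS; set D := (X in _ / X) in B *.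
have e1 : 1 <= expR 1 :> R by rewrite -expR0 ler_expR.
have n0 : 0 < n%:R :> R by rewrite ltr0n.
have N0 : 0 < N%:R :> R.
  by apply: le_lt_trans lt_N; rewrite !mulr_ge0 ?sqrtr_ge0 ?expR_ge0 // ltW.
have D0 : 0 < D.
  rewrite subr_gt0; have : (Num.sqrt 48 * expR 1 * n%:R) ^+ 2 < N%:R ^+ 2 :> R.
    by rewrite ltr_pXn2r // nnegrE ?mulr_ge0 ?sqrtr_ge0 ?expR_ge0 // ltW.
  by rewrite !exprMn sqr_sqrtr.
(* [y] is the ratio given by the path bound; [x] is the larger ratio for which [1 - x] is
   [D / N%:R ^+ 2], the source of the denominator in the claim. *)
pose x : R := 48 * expR 1 ^+ 2 * n%:R ^+ 2 / N%:R ^+ 2.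
pose y : R := 32 * n%:R ^+ 2 / N%:R ^+ 2.
have y0 : 0 <= y by rewrite divr_ge0 // mulr_ge0.
have yx : y <= x.
  rewrite ler_pM2r ?invr_gt0 ?exprn_gt0 // ler_pM2r ?exprn_gt0 //.
  have : 1 <= expR 1 ^+ 2 :> R by rewrite exprn_ege1.
  lra.
have x0 : 0 <= x by apply: le_trans yx.
have x1 : 1 - x = D / N%:R ^+ 2.
  by rewrite /x /D mulrBl divff // expf_neq0 // gt_eqF.
set u := fun g : nat => (npaths s (k + 2 * g)%N)%:R * N%:R ^- (2 * g)%N : R.
have B0 : 0 <= B by rewrite divr_ge0 ?mulr_ge0 ?ler0n // ltW.
have uS g : u g.+1 <= B * (1 - x) * x ^+ g.
  rewrite x1 /B mulrA divfK ?gt_eqF //.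
  have : u g.+1 <= (2 ^ k * k`!)%N%:R * y ^+ g.+1.
    rewrite /y expr_div_n mulrA -exprM /u ler_pM2r ?invr_gt0 ?exprn_gt0 //.
    rewrite -natrX -natrM -natrX -natrM ler_nat.
    exact: leq_trans (npaths_leq_genus_bound _ _) (genus_bound_leq _ _ _).
  move/le_trans; apply.
  have -> : 32 * (2 ^ k * k`!)%N%:R * n%:R ^+ 2 / N%:R ^+ 2 =
      (2 ^ k * k`!)%N%:R * y.
    by rewrite /y [32 * _%:R]mulrC -!mulrA.
  by rewrite exprS mulrA !ler_wpM2l ?mulr_ge0 ?ler0n // lerXn2r.
have u0 g : 0 <= u g by rewrite divr_ge0.
have /andP[lo hi] := le_lim_series_bounded u0
  (fun m => series_geometric_bound m x0 B0 uS).
(* [Moeb R s] is the sign times the term [g = 0], so the difference is the tail of the series up to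
   sign. *)
rewrite /WgU /Moeb -npaths_plength -/k -/u mulrA mulrCA.
rewrite divff ?expf_neq0 ?gt_eqF // mulr1.
rewrite -mulrBr normrM normrX normrN1 expr1n mul1r ger0_norm; last first.
  by rewrite subr_ge0; move: lo; rewrite /u muln0 addn0 expr0 invr1 mulr1.
by move: hi; rewrite /u muln0 addn0 expr0 invr1 mulr1 -lerBlDl.
Qed.
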